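(* For the Invincible Fighter ($u=1$), property [A] holds: for every fixed $n\ge 1$, $K(n,t)$ is non-increasing in $t$, $t\ge 0$.
   Context: Fighter problem with discrete ammunition. Fix $u\in[0,1]$ and a sequence of probabilities $0=a(0)<a(1)<a(2)<\cdots$ (each $a(j)\in[0,1]$) that is strictly increasing and concave, i.e. $a(j+2)-a(j+1)\le a(j+1)-a(j)$ for all $j\ge 0$. Here $a(j)$ is the probability that an enemy plane is shot down when $j$ missiles are spent on it; if it is not shot down, the fighter survives with probability $u$; enemies arrive according to a Poisson process of rate $1$. Put $c(j)=a(j)+u(1-a(j))$. For $t\ge 0$ (remaining flying time) define inductively on $n$: $N(0,t)=0$; for $r\ge 0$, $N^*(r,t)=e^{-t}\int_0^t N(r,x)e^x\,dx$ (so $N^*(0,t)=0$); for $n\ge 1$ and $1\le j\le n$, $N_n(j,t)=a(j)+c(j)N^*(n-j,t)$; and $N(n,t)=\max_{1\le j\le n}N_n(j,t)$. The optimal spending policy (smallest optimal number of missiles) is, for $n\ge1$, $K(n,t)=\min\{j\in\{1,\dots,n\}: N_n(j,t)=\max_{1\le i\le n}N_n(i,t)\}$. The Invincible Fighter is the case $u=1$, for which $c(j)=1$ and $N_n(j,t)=a(j)+N^*(n-j,t)$. *)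

(* Defs.v *)
From Stdlib Require Import Reals RList Lra Lia List Arith.
From Coquelicot Require Import Coquelicot.
Open Scope R_scope.

Definition hit_prob_seq (a : nat -> R) : Prop :=
  a 0%nat = 0 /\
  (forall j, 0 <= a j <= 1) /\
  (forall j, a j < a (S j)) /\
  (forall j, a (S (S j)) - a (S j) <= a (S j) - a j).

Definition c (a : nat -> R) (u : R) (j : nat) : R := a j + u * (1 - a j).

(* The operator f |-> f^*, so that N^*(r, .) is [star (N r)]. *)
Definition star (f : R -> R) (t : R) : R :=
  exp (- t) * RInt (fun x => f x * exp x) 0 t.

(* N_n(j, t), with the family M standing for N(0, .), ..., N(n-1, .). *)
Definition spend (a : nat -> R) (u : R) (M : nat -> R -> R) (n j : nat) (t : R) : R :=
  a j + c a u j * star (M (n - j)%nat) t.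

(* Maximum over 1 <= j <= n; only meaningful for n >= 1. *)
Definition max_upto (n : nat) (f : nat -> R) : R := MaxRlist (map f (seq 1 n)).

(* Course-of-values recursion: [Ntab n r] is N(r, .) for every r <= n.
   The recursion equations are [N_0] and [N_S] below. *)
Fixpoint Ntab (a : nat -> R) (u : R) (n : nat) : nat -> R -> R :=
  match n with
  | O => fun _ _ => 0
  | S m => fun r t =>
      if (r <=? m)%nat then Ntab a u m r t
      else max_upto n (fun j => spend a u (Ntab a u m) n j t)
  end.

Definition N (a : nat -> R) (u : R) (n : nat) : R -> R := Ntab a u n n.

Definition Nstar (a : nat -> R) (u : R) (r : nat) : R -> R := star (N a u r).

Definition Nspend (a : nat -> R) (u : R) (n j : nat) (t : R) : R :=
  a j + c a u j * Nstar a u (n - j) t.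

(* The default 0 is never reached when n >= 1: see [K_spec]. *)
Definition K (a : nat -> R) (u : R) (n : nat) (t : R) : nat :=
  match find
          (fun j => if Req_dec_T (Nspend a u n j t)
                                 (max_upto n (fun i => Nspend a u n i t))
                    then true else false)
          (seq 1 n)
  with
  | Some j => j
  | None => 0%nat
  end.

Definition property_A (a : nat -> R) (u : R) : Prop :=
  forall n : nat, (1 <= n)%nat ->
  forall s t : R, 0 <= s -> s <= t -> (K a u n t <= K a u n s)%nat.

Lemma Ntab_le a u n r t : (r <= n)%nat -> Ntab a u n r t = N a u r t.
Proof.
  induction n as [|n IH]; intros H.
  - now replace r with 0%nat by lia.
  - destruct (Nat.eq_dec r (S n)) as [->|H']; [reflexivity|].
    simpl. rewrite (proj2 (Nat.leb_le r n)) by lia. apply IH; lia.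
Qed.

Lemma N_0 a u t : N a u 0 t = 0.
Proof. reflexivity. Qed.

Lemma N_S a u n t : (1 <= n)%nat ->
  N a u n t = max_upto n (fun j => Nspend a u n j t).
Proof.
  intros Hn. destruct n as [|m]; [lia|].
  unfold N at 1; cbn [Ntab].
  rewrite (proj2 (Nat.leb_gt (S m) m)) by lia.
  unfold max_upto; f_equal; apply map_ext_in; intros j Hj.
  apply in_seq in Hj.
  unfold spend, Nspend, Nstar, star. do 3 f_equal.
  apply RInt_ext; intros x _. rewrite Ntab_le by lia. reflexivity.
Qed.

Lemma max_upto_ge n f j : (1 <= j <= n)%nat -> f j <= max_upto n f.
Proof.
  intros H. apply MaxRlist_P1. apply in_map, in_seq. lia.
Qed.

Lemma max_upto_attained n f : (1 <= n)%nat ->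
  exists j, (1 <= j <= n)%nat /\ f j = max_upto n f.
Proof.
  intros H.
  assert (Hin : In (max_upto n f) (map f (seq 1 n))).
  { apply MaxRlist_P2. exists (f 1%nat). apply in_map, in_seq. lia. }
  apply in_map_iff in Hin. destruct Hin as [j [Hj Hs]].
  exists j. split; [apply in_seq in Hs; lia|exact Hj].
Qed.

Lemma find_seq_min (p : nat -> bool) len s j : find p (seq s len) = Some j ->
  (s <= j < s + len)%nat /\ p j = true /\
  forall i, (s <= i < j)%nat -> p i = false.
Proof.
  revert s. induction len as [|len IH]; intros s; simpl; [discriminate|].
  destruct (p s) eqn:E.
  - intros H; injection H as ->. split; [lia|]. split; [exact E|].
    intros i Hi; exfalso; lia.
  - intros H. destruct (IH _ H) as (H1 & H2 & H3).
    split; [lia|]. split; [exact H2|].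
    intros i Hi. destruct (Nat.eq_dec i s) as [->|]; [assumption|apply H3; lia].
Qed.

Lemma K_spec a u n t : (1 <= n)%nat ->
  (1 <= K a u n t <= n)%nat /\
  Nspend a u n (K a u n t) t = max_upto n (fun i => Nspend a u n i t) /\
  (forall j, (1 <= j < K a u n t)%nat ->
     Nspend a u n j t <> max_upto n (fun i => Nspend a u n i t)).
Proof.
  intros Hn. unfold K.
  destruct (find _ _) as [k|] eqn:E.
  - apply find_seq_min in E. destruct E as (H1 & H2 & H3).
    split; [lia|]. split.
    + destruct (Req_dec_T _ _) in H2; [assumption|discriminate].
    + intros j Hj. specialize (H3 j Hj). cbv beta in H3.
      destruct (Req_dec_T _ _) in H3; [discriminate|assumption].
  - destruct (max_upto_attained n (fun i => Nspend a u n i t) Hn) as [j [Hj Ej]].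
    assert (Hs : In j (seq 1 n)) by (apply in_seq; lia).
    pose proof (find_none _ _ E j Hs) as F. cbv beta in F.
    destruct (Req_dec_T _ _) in F; [discriminate|contradiction].
Qed.

(* Main.v *)
(** For [u = 1] write [W n t] for N^*(n,t); it satisfies [W n' = N n - W n], and
    N(n,.) is the sup-convolution of the concave sequence [a] with [W].  By
    induction on [n], both N(n,t) and [W n t] are concave in [n].  Concavity
    makes [N n - W n = max_j (a j - (W n - W (n - j)))] non-decreasing in [n], so
    every difference [W (n - i) - W (n - j)] with [i < j] is non-decreasing in
    [t]: as [t] grows, spending less gains on spending more. *)
From Stdlib Require Import Reals RList Lra Lia List Arith.
From Coquelicot Require Import Coquelicot.
Require Import Defs.
Open Scope R_scope.

(** * Concave sequences and continuity of finite maxima *)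

(** Concavity is required only up to [n], so that the lemma also applies inside an induction where
    it is known for small indices only. *)
Lemma increments_antitone (f : nat -> R) (n i j : nat) :
  (forall k, (k + 2 <= n)%nat -> f (S (S k)) - f (S k) <= f (S k) - f k) ->
  (i <= j)%nat -> (j + 1 <= n)%nat ->
  f (S j) - f j <= f (S i) - f i.
Proof.
  intros Hf Hij; induction Hij as [|j Hij IH]; intros Hj; [lra|].
  assert (IHj : f (S j) - f j <= f (S i) - f i) by (apply IH; lia).
  assert (Hc := Hf j ltac:(lia)); lra.
Qed.

Lemma continuous_Rmax (f g : R -> R) (x : R) :
  continuous f x -> continuous g x -> continuous (fun y => Rmax (f y) (g y)) x.
Proof.
  intros Hf Hg.
  apply continuous_ext with (fun y => / 2 * (f y + g y + Rabs (f y - g y))).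
  - intros y; unfold Rmax, Rabs.
    destruct (Rle_dec (f y) (g y)), (Rcase_abs (f y - g y)); lra.
  - apply (continuous_scal_r (/ 2) (fun y => f y + g y + Rabs (f y - g y))).
    apply (continuous_plus (fun y => f y + g y) (fun y => Rabs (f y - g y))).
    + now apply (continuous_plus f g).
    + apply (continuous_comp (fun y => f y - g y) Rabs).
      * now apply (continuous_minus f g).
      * apply continuous_Rabs.
Qed.

Lemma continuous_MaxRlist (F : nat -> R -> R) (l : list nat) (x : R) :
  (forall j, In j l -> continuous (F j) x) ->
  continuous (fun y => MaxRlist (map (fun j => F j y) l)) x.
Proof.
  (* [MaxRlist] is 0 on the empty list but does not take 0 into account on longer ones, so
     singletons form a base case of their own. *)
  induction l as [|i [|j l] IH]; intros H.
  - apply continuous_const.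
  - apply H; now left.
  - apply (continuous_Rmax (F i)
             (fun y => MaxRlist (map (fun j => F j y) (j :: l)))).
    + apply H; now left.
    + apply IH; intros k Hk; apply H; now right.
Qed.

(** * The operator [star]: differential equation, linearity, monotonicity *)

Lemma continuous_mul_exp (f : R -> R) (x : R) :
  continuous f x -> continuous (fun y => f y * exp y) x.
Proof.
  intros Hf; apply (continuous_mult f exp); [exact Hf|apply continuous_exp].
Qed.

Lemma ex_RInt_mul_exp (f : R -> R) (s t : R) :
  (forall x, continuous f x) -> ex_RInt (fun x => f x * exp x) s t.
Proof.
  intros Hf; apply (ex_RInt_continuous (V := R_CompleteNormedModule)).
  intros x _; now apply continuous_mul_exp.
Qed.

(** Product rule: differentiating the factor [exp (- t)] gives [- star f t]; differentiating the
    integral gives [f t * exp t], whose exponential cancels. *)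
Lemma is_derive_star (f : R -> R) (t : R) :
  (forall x, continuous f x) -> is_derive (star f) t (f t - star f t).
Proof.
  intros Hf.
  assert (HI : is_derive (fun t => RInt (fun x => f x * exp x) 0 t) t
                         (f t * exp t)).
  { apply (is_derive_RInt (fun x => f x * exp x)
             (fun t => RInt (fun x => f x * exp x) 0 t) 0).
    - apply filter_forall; intros y.
      apply (RInt_correct (V := R_CompleteNormedModule)).
      now apply ex_RInt_mul_exp.
    - now apply continuous_mul_exp. }
  assert (HE : is_derive (fun t => exp (- t)) t (- exp (- t)))
    by (auto_derive; [trivial|ring]).
  assert (H := is_derive_mult _ _ _ _ _ HE HI Rmult_comm).
  replace (f t - star f t) with
    (plus (mult (- exp (- t)) (RInt (fun x => f x * exp x) 0 t))
          (mult (exp (- t)) (f t * exp t))); [exact H|].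
  assert (E : exp (- t) * exp t = 1)
    by (rewrite <- exp_plus, Rplus_opp_l; apply exp_0).
  unfold star, plus, mult; simpl.
  transitivity (f t * (exp (- t) * exp t)
                - exp (- t) * RInt (fun x => f x * exp x) 0 t); [ring|].
  rewrite E; ring.
Qed.

Lemma continuous_star (f : R -> R) (t : R) :
  (forall x, continuous f x) -> continuous (star f) t.
Proof.
  intros Hf; apply (ex_derive_continuous (star f)).
  eexists; now apply is_derive_star.
Qed.

Lemma star_ext (f g : R -> R) (t : R) :
  (forall x, f x = g x) -> star f t = star g t.
Proof.
  intros E; unfold star; f_equal; apply RInt_ext; intros x _; now rewrite E.
Qed.

(** Serves the base cases: with 0 missiles, or with 1 when [u = 1], the value is constant in
    time. *)
Lemma star_const (k t : R) : star (fun _ => k) t = k * (1 - exp (- t)).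
Proof.
  unfold star.
  assert (H : is_RInt (fun x => k * exp x) 0 t (minus (k * exp t) (k * exp 0))).
  { apply (is_RInt_derive (fun x => k * exp x) (fun x => k * exp x)).
    - intros x _; auto_derive; [trivial|ring].
    - intros x _; apply (continuous_mul_exp (fun _ => k)), continuous_const. }
  rewrite (is_RInt_unique _ _ _ _ H), exp_0.
  assert (E : exp (- t) * exp t = 1)
    by (rewrite <- exp_plus, Rplus_opp_l; apply exp_0).
  unfold minus, plus, opp; simpl.
  transitivity (k * (exp (- t) * exp t) - k * exp (- t)); [ring|].
  rewrite E; ring.
Qed.

Lemma star_plus (f g : R -> R) (t : R) :
  (forall x, continuous f x) -> (forall x, continuous g x) ->
  star (fun x => f x + g x) t = star f t + star g t.
Proof.
  intros Hf Hg; unfold star; rewrite <- Rmult_plus_distr_l; f_equal.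
  transitivity (RInt (fun x => plus (f x * exp x) (g x * exp x)) 0 t).
  - apply RInt_ext; intros x _; unfold plus; simpl; ring.
  - apply (RInt_plus (V := R_CompleteNormedModule)); now apply ex_RInt_mul_exp.
Qed.

Lemma star_le (f g : R -> R) (t : R) :
  (forall x, continuous f x) -> (forall x, continuous g x) ->
  0 <= t -> (forall x, 0 <= x -> f x <= g x) -> star f t <= star g t.
Proof.
  intros Hf Hg Ht Hle; apply Rmult_le_compat_l; [left; apply exp_pos|].
  apply RInt_le; [exact Ht|now apply ex_RInt_mul_exp..|].
  intros x Hx; apply Rmult_le_compat_r; [left; apply exp_pos|].
  apply Hle; lra.
Qed.

(** * The value functions and their recursion for [u = 1] *)

Lemma continuous_N (a : nat -> R) (u : R) (n : nat) (t : R) :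
  continuous (N a u n) t.
Proof.
  revert t; induction n as [n IH] using (well_founded_induction lt_wf); intros t.
  destruct n as [|m]; [apply continuous_const|].
  apply continuous_ext with
    (fun t => max_upto (S m) (fun j => Nspend a u (S m) j t)).
  { intros x; symmetry; apply N_S; lia. }
  apply (continuous_MaxRlist (fun j t => Nspend a u (S m) j t)).
  intros j Hj; apply in_seq in Hj.
  apply (continuous_plus (fun _ => a j)
           (fun t => c a u j * Nstar a u (S m - j) t)).
  - apply continuous_const.
  - apply (continuous_scal_r (c a u j) (Nstar a u (S m - j))).
    apply continuous_star; intros x; apply IH; lia.
Qed.

Lemma Nspend_invincible (a : nat -> R) (n j : nat) (t : R) :
  Nspend a 1 n j t = a j + Nstar a 1 (n - j) t.
Proof. unfold Nspend, c; ring. Qed.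

Lemma N_invincible_ge (a : nat -> R) (n j : nat) (t : R) :
  (1 <= j <= n)%nat -> a j + Nstar a 1 (n - j) t <= N a 1 n t.
Proof.
  intros Hj; rewrite N_S, <- Nspend_invincible by lia.
  now apply (max_upto_ge n (fun j => Nspend a 1 n j t)).
Qed.

Lemma N_invincible_attained (a : nat -> R) (n : nat) (t : R) :
  (1 <= n)%nat ->
  exists j, (1 <= j <= n)%nat /\ N a 1 n t = a j + Nstar a 1 (n - j) t.
Proof.
  intros Hn.
  destruct (max_upto_attained n (fun j => Nspend a 1 n j t) Hn) as [j [Hj E]].
  exists j; split; [exact Hj|].
  now rewrite N_S, <- E, Nspend_invincible by lia.
Qed.

Lemma Nstar_0 (a : nat -> R) (u t : R) : Nstar a u 0 t = 0.
Proof.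
  unfold Nstar; rewrite (star_ext _ (fun _ => 0)), star_const by reflexivity; ring.
Qed.

Lemma N_invincible_1 (a : nat -> R) (t : R) : N a 1 1 t = a 1%nat.
Proof.
  destruct (N_invincible_attained a 1 t ltac:(lia)) as [j [Hj E]].
  replace j with 1%nat in E by lia.
  rewrite E; simpl; rewrite Nstar_0; ring.
Qed.

Lemma Nstar_invincible_1_le (a : nat -> R) (t : R) :
  0 <= a 1%nat -> Nstar a 1 1 t <= a 1%nat.
Proof.
  intros Ha; unfold Nstar.
  rewrite (star_ext _ (fun _ => a 1%nat)), star_const by apply N_invincible_1.
  assert (0 <= a 1%nat * exp (- t))
    by (apply Rmult_le_pos; [exact Ha|left; apply exp_pos]).
  lra.
Qed.

(** The operator [star] is linear and monotone, so it passes concavity in the stock on from N to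
    N^*. *)
Lemma Nstar_concave (a : nat -> R) (u : R) (k : nat) (t : R) :
  0 <= t ->
  (forall x, 0 <= x ->
     N a u (S (S k)) x - N a u (S k) x <= N a u (S k) x - N a u k x) ->
  Nstar a u (S (S k)) t - Nstar a u (S k) t <= Nstar a u (S k) t - Nstar a u k t.
Proof.
  intros Ht H; unfold Nstar.
  assert (L : star (fun x => N a u (S (S k)) x + N a u k x) t
              <= star (fun x => N a u (S k) x + N a u (S k) x) t).
  { apply star_le; [..|exact Ht|].
    - intros x; apply (continuous_plus (N a u (S (S k))) (N a u k));
        apply continuous_N.
    - intros x; apply (continuous_plus (N a u (S k)) (N a u (S k)));
        apply continuous_N.
    - intros x Hx; specialize (H x Hx); lra. }
  rewrite !star_plus in L by apply continuous_N; lra.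
Qed.

(** * Concavity in the stock and monotonicity in time *)

Section Invincible.

Variable a : nat -> R.
Hypothesis ha : hit_prob_seq a.

Let a_nonneg (j : nat) : 0 <= a j.
Proof. now apply ha. Qed.

Let a_increments (i j : nat) : (i <= j)%nat -> a (S j) - a j <= a (S i) - a i.
Proof.
  intros Hij; apply (increments_antitone a (j + 1)); [|exact Hij|lia].
  intros k _; apply ha.
Qed.

Lemma N_invincible_concave (n : nat) (t : R) :
  0 <= t ->
  N a 1 (S (S n)) t - N a 1 (S n) t <= N a 1 (S n) t - N a 1 n t.
Proof.
  revert t; induction n as [n IH] using (well_founded_induction lt_wf).
  intros t Ht.
  destruct (N_invincible_attained a (S (S n)) t ltac:(lia)) as [j [Hj Ej]].
  destruct n as [|n].
  (* The claim is [N a 1 2 t <= 2 * a 1]. For [j = 1] it follows from N^*(1,t) being at most [a 1],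
     for [j = 2] from concavity of [a] and [a 0 = 0]. *)
  - rewrite Ej, N_0, N_invincible_1.
    assert (a0 : a 0%nat = 0) by apply ha.
    assert (W1 := Nstar_invincible_1_le a t (a_nonneg 1)).
    assert (a2 := a_increments 0 1 ltac:(lia)).
    destruct j as [|[|[|j]]]; try lia; simpl; rewrite ?Nstar_0; lra.
  - destruct (N_invincible_attained a (S n) t ltac:(lia)) as [i [Hi Ei]].
    rewrite Ej, Ei.
    (* Exchange argument: one missile moves from the larger to the smaller
       problem, either in the first salvo or in the remaining stock. *)
    destruct (le_lt_dec j i) as [Hji|Hij].
    (* Both salvos [j] and [i] are kept, and the missile moves between the remaining stocks. Since
       [j] is at least 1, these stocks stay within [S (S n)], where the induction hypothesis gives
       concavity of N^*. *)
    + assert (G1 := N_invincible_ge a (S (S n)) j t ltac:(lia)).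
      assert (G2 := N_invincible_ge a (S (S n)) i t ltac:(lia)).
      assert (C := increments_antitone (fun k => Nstar a 1 k t) (S (S n))
                     (S n - i) (S (S n) - j)).
      cbv beta in C.
      replace (S (S (S n)) - j)%nat with (S (S (S n) - j)) by lia.
      replace (S (S n) - i)%nat with (S (S n - i)) in G2 by lia.
      enough (Nstar a 1 (S (S (S n) - j)) t - Nstar a 1 (S (S n) - j) t
              <= Nstar a 1 (S (S n - i)) t - Nstar a 1 (S n - i) t) by lra.
      apply C; [|lia|lia].
      intros k Hk; apply Nstar_concave; [exact Ht|].
      intros x Hx; apply IH; [lia|exact Hx].
    (* Both remaining stocks are kept, and the missile moves from the larger salvo to the smaller
       one; concavity of [a] suffices. *)
    + destruct j as [|j]; [lia|].
      assert (G1 := N_invincible_ge a (S (S n)) j t ltac:(lia)).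
      assert (G2 := N_invincible_ge a (S (S n)) (S i) t ltac:(lia)).
      assert (C := a_increments i j ltac:(lia)).
      simpl in *; lra.
Qed.

Lemma Nstar_invincible_increments (i j : nat) (t : R) :
  0 <= t -> (i <= j)%nat ->
  Nstar a 1 (S j) t - Nstar a 1 j t <= Nstar a 1 (S i) t - Nstar a 1 i t.
Proof.
  intros Ht Hij.
  apply (increments_antitone (fun k => Nstar a 1 k t) (j + 1)); [|exact Hij|lia].
  intros k _; apply Nstar_concave; [exact Ht|]; apply N_invincible_concave.
Qed.

(** A salvo optimal for the smaller stock stays available when a missile is added. That missile
    joins the remaining stock, where by concavity it is worth at least as much as on top of the full
    stock. *)
Lemma Nstar_invincible_slope (n : nat) (t : R) :
  0 <= t ->
  N a 1 n t - Nstar a 1 n t <= N a 1 (S n) t - Nstar a 1 (S n) t.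
Proof.
  intros Ht; destruct n as [|n].
  - rewrite N_0, Nstar_0, N_invincible_1.
    assert (W1 := Nstar_invincible_1_le a t (a_nonneg 1)); lra.
  - destruct (N_invincible_attained a (S n) t ltac:(lia)) as [j [Hj ->]].
    assert (G := N_invincible_ge a (S (S n)) j t ltac:(lia)).
    assert (C := Nstar_invincible_increments (S n - j) (S n) t Ht ltac:(lia)).
    replace (S (S n) - j)%nat with (S (S n - j)) in G by lia; lra.
Qed.

Lemma Nstar_invincible_increment_incr (n : nat) (s t : R) :
  0 <= s <= t ->
  Nstar a 1 (S n) s - Nstar a 1 n s <= Nstar a 1 (S n) t - Nstar a 1 n t.
Proof.
  intros [Hs Hst].
  set (D := fun x => Nstar a 1 (S n) x - Nstar a 1 n x).
  (* This is the derivative of [D] given by [is_derive_star]; [Nstar_invincible_slope] makes it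
     non-negative at non-negative times. *)
  set (D' := fun x => (N a 1 (S n) x - Nstar a 1 (S n) x)
                      - (N a 1 n x - Nstar a 1 n x)).
  assert (HD : forall x, is_derive D x (D' x)).
  { intros x; apply (is_derive_minus (Nstar a 1 (S n)) (Nstar a 1 n));
      apply is_derive_star, continuous_N. }
  destruct (MVT_gen D s t D') as [x [Hx E]].
  - intros x _; apply HD.
  - intros x _; apply continuity_pt_filterlim.
    apply (ex_derive_continuous D); eexists; apply HD.
  - rewrite Rmin_left, Rmax_right in Hx by lra.
    assert (0 <= D' x * (t - s)).
    { apply Rmult_le_pos; [|lra].
      assert (L := Nstar_invincible_slope n x ltac:(lra)); unfold D'; lra. }
    change (D s <= D t); lra.
Qed.

Lemma Nstar_invincible_difference_incr (m n : nat) (s t : R) :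
  0 <= s <= t -> (m <= n)%nat ->
  Nstar a 1 n s - Nstar a 1 m s <= Nstar a 1 n t - Nstar a 1 m t.
Proof.
  intros Hst Hmn; induction Hmn as [|n Hmn IH]; [lra|].
  assert (H := Nstar_invincible_increment_incr n s t Hst); lra.
Qed.

End Invincible.

Theorem theorem4p1 (a : nat -> R) (ha : hit_prob_seq a) : property_A a 1.
Proof.
  intros n Hn s t Hs Hst.
  destruct (K_spec a 1 n s Hn) as (Ks & Es & _).
  destruct (K_spec a 1 n t Hn) as (Kt & Et & Mt).
  destruct (le_lt_dec (K a 1 n t) (K a 1 n s)) as [|Hlt]; [assumption|exfalso].
  set (k := K a 1 n t) in *; set (i := K a 1 n s) in *.
  (* At time [s] salvo [i] does at least as well as [k], and its advantage in remaining stock only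
     grows up to [t]. So [i < k] is optimal at [t] too, against the minimality of [k]. *)
  apply (Mt i); [lia|]; apply Rle_antisym;
    [now apply (max_upto_ge n (fun i => Nspend a 1 n i t))|].
  assert (G := max_upto_ge n (fun i => Nspend a 1 n i s) k Kt).
  rewrite <- Es in G; rewrite <- Et; rewrite !Nspend_invincible in *.
  assert (D := Nstar_invincible_difference_incr a ha (n - k) (n - i) s t
                 ltac:(lra) ltac:(lia)).
  lra.
Qed.
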